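(* Let $p\ge1$. In the sequence model $Y_\lambda=\theta_\lambda+\varepsilon\xi_\lambda$, let $\mathcal M$ be a non-empty collection of subsets of $\Lambda^{(N)}$, let $x_{m_j}\ge1$ be given for each $j\in\mathcal J$ and $m_j\in\mathcal M_j$, and let $\tilde\theta=\hat\theta^{(\hat m)}$ be the PCO estimator associated with the penalty $$\mathrm{pen}(m)=2\varepsilon^p\sum_{j\in\mathcal J}\omega_j\,\mathrm p_j(m_j),\qquad \mathrm p_j(m_j)=\frac32\sigma_p^p|m_j|+\kappa_p2^{\frac{(p-2)_+}2}|m_j|^{(1-\frac p2)_+}x_{m_j}^{\frac p2}.$$ Then $$\mathbb E\big[\|\tilde\theta-\theta\|_p^p\big]\le\tilde M_p\inf_{m\in\mathcal M}\Big\{\mathbb E\big[\|\hat\theta^{(m)}-\theta\|_p^p\big]+\mathrm{pen}(m)\Big\}+\breve M_p\,\varepsilon^pR(\mathcal M),$$ with $$R(\mathcal M)=\sum_{j\in\mathcal J}\omega_j\sum_{m_j\in\mathcal M_j,\ m_j\ne\emptyset}|m_j|^{(1-\frac p2)_+}e^{-x_{m_j}},$$ where $\tilde M_p$ and $\breve M_p$ are two constants depending only on $p$ and $\sigma_p$.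
   Context: Model: $\Lambda$ is a countable set, $\Lambda^{(N)}$ is the set of its first $N$ elements, $0<\varepsilon\le 1$, $\theta=(\theta_\lambda)_{\lambda\in\Lambda}$ is an unknown real sequence, and $Y_\lambda=\theta_\lambda+\varepsilon\xi_\lambda$, where the $\xi_\lambda$ are i.i.d. centered real random variables with $\mathbb P(|\xi_\lambda|\ge t)\le 2e^{-t^2/2}$ for all $t\ge0$. $\sigma_p=(\mathbb E|\xi_\lambda|^p)^{1/p}>0$. Norm: $w=(w_\lambda)_{\lambda\in\Lambda}$ are non-negative weights and $\|\vartheta\|_p^p=\sum_{\lambda\in\Lambda}w_\lambda|\vartheta_\lambda|^p$. It is assumed that $\|\theta\|_p<\infty$. Estimators: for $m\subset\Lambda^{(N)}$, $\hat\theta^{(m)}=(Y_\lambda\mathbf 1_{\{\lambda\in m\}})_{\lambda\in\Lambda}$. The PCO estimator associated with $\mathrm{pen}$ is $\tilde\theta=\hat\theta^{(\hat m)}$, where $\hat m$ is a minimizer over $m\in\mathcal M$ of $-\sum_{\lambda\in m}w_\lambda|Y_\lambda|^p+\mathrm{pen}(m)$. Partition: $\Lambda^{(N)}=\bigcup_{j\in\mathcal J}\Lambda_j$ is the partition into the level sets of the weights: $w_\lambda=\omega_j$ for all $\lambda\in\Lambda_j$, and $\omega_j\ne\omega_{j'}$ if $j\ne j'$. For $m\in\mathcal M$, $m_j=m\cap\Lambda_j$, and $\mathcal M_j=\{m_j:\ m\in\mathcal M\}$. $|\cdot|$ is cardinality, $(u)_+=\max(u,0)$, and $0^0=1$. Constant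 $\kappa_p$: $\kappa_p=c_{2,p}+c_{1,p}\max(1,c_{1,p}/(2\sigma_p^p))$, where $c_{1,p},c_{2,p}>0$ are constants depending only on $p$ such that, for every finite family $(\xi_\lambda)_{\lambda\in\mathcal I}$, $|\mathcal I|=D$, of i.i.d. centered variables with $\mathbb P(|\xi_\lambda|\ge t)\le2e^{-t^2/2}$ for all $t\geq 0$, and every $x>0$, $\mathbb P\big(\big|\sum_{\lambda\in\mathcal I}|\xi_\lambda|^p-D\sigma_p^p\big|\ge c_{1,p}\sqrt{Dx}+c_{2,p}D^{(1-p/2)_+}x^{p/2}\big)\le2e^{-x}$ (such constants exist). Consequently, for every $x\ge1$, $\sum_{\lambda\in\mathcal I}|\xi_\lambda|^p\le\frac32\sigma_p^pD+\kappa_pD^{(1-p/2)_+}x^{p/2}$ with probability at least $1-2e^{-x}$. *)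

(* Defs.v *)
From HB Require Import structures.
From mathcomp Require Import all_boot all_order all_algebra finmap.
From mathcomp Require Import all_classical all_reals all_analysis.

Set Implicit Arguments.
Unset Strict Implicit.
Unset Printing Implicit Defensive.

Import Order.TTheory GRing.Theory Num.Theory.
Import numFieldNormedType.Exports.

Local Open Scope classical_set_scope.
Local Open Scope ring_scope.

Definition mutually_independent (R : realType) (d : measure_display)
    (T : measurableType d) (P : probability T R) (I : choiceType)
    (X : I -> {RV P >-> R}) : Prop :=
  forall (F : {fset I}) (B : I -> set R), (forall i, measurable (B i)) ->
    P (\bigcap_(i in [set` F]) (X i @^-1` B i))
    = (\prod_(i <- F) P (X i @^-1` B i))%E.

Definition identically_distributed (R : realType) (d : measure_display)
    (T : measurableType d) (P : probability T R) (I : choiceType)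
    (X : I -> {RV P >-> R}) : Prop :=
  forall (i j : I) (B : set R), measurable B ->
    distribution P (X i) B = distribution P (X j) B.

(* The tail bound makes every xi i integrable, so that the condition on the
   expectation is meaningful. *)
Definition subgaussian_iid (R : realType) (d : measure_display)
    (T : measurableType d) (P : probability T R) (I : choiceType)
    (xi : I -> {RV P >-> R}) : Prop :=
  [/\ mutually_independent xi,
      identically_distributed xi,
      forall i, ('E_P[xi i] = 0)%E &
      forall i (t : R), 0 <= t ->
        (P [set o | (t <= `|xi i o|)%R] <= (2 * expR (- (t ^+ 2 / 2)))%:E)%E].

(* c1 and c2 have to work for all families on all probability spaces. The family
   is nonempty: for D = 0 and p < 2 the event would be 0 >= 0, and no c1, c2
   would satisfy the bound. *)
Definition concentration_constants (R : realType) (p c1 c2 : R) : Prop :=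
  forall (d : measure_display) (T : measurableType d) (P : probability T R)
    (I : finType) (xi : I -> {RV P >-> R}) (sigma : R),
  (0 < #|I|)%N -> subgaussian_iid xi ->
  (forall i, 'N[P]_p%:E[EFin \o xi i]%E = sigma%:E) ->
  forall x : R, 0 < x ->
  let D : R := #|I|%:R in
  (P [set o | (c1 * Num.sqrt (D * x)
               + c2 * D `^ Num.max (1 - p / 2) 0 * x `^ (p / 2)
               <= `| \sum_(i : I) `|xi i o| `^ p - D * sigma `^ p |)%R ]
   <= (2 * expR (- x))%:E)%E.

Definition kappa (R : realType) (p c1 c2 sigma : R) : R :=
  c2 + c1 * Num.max 1 (c1 / (2 * sigma `^ p)).

(* An enumeration of a countable set, finite or infinite, is given by ranks
   forming an initial segment of nat; the first N elements are those of
   rank < N. *)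
Definition enumeration (L : Type) (rk : L -> nat) : Prop :=
  injective rk /\
  forall (l : L) (k : nat), (k < rk l)%N -> exists l' : L, rk l' = k.

Definition first_elements (L : Type) (rk : L -> nat) (N : nat) : set L :=
  [set l | (rk l < N)%N].

(* The blocks are pairwise disjoint because omega is injective. *)
Definition level_partition (R : realType) (L : choiceType) (A : set L)
    (w : L -> R) (J : finType) (Lam : J -> {fset L}) (omega : J -> R) : Prop :=
  [/\ A = \bigcup_(j in [set: J]) [set` Lam j],
      forall j, Lam j != fset0,
      forall j l, l \in Lam j -> w l = omega j &
      injective omega].

Definition lp_loss (R : realType) (L : choiceType) (w : L -> R) (p : R)
    (v : L -> R) : \bar R :=
  (\esum_(l in [set: L]) (w l * `|v l| `^ p)%:E)%E.

Definition observation (R : realType) (L T : Type) (theta : L -> R) (eps : R)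
    (xi : L -> T -> R) (o : T) : L -> R :=
  fun l => theta l + eps * xi l o.

Definition proj_estimator (R : realType) (L : choiceType) (y : L -> R)
    (m : {fset L}) : L -> R :=
  fun l => if l \in m then y l else 0.

Definition pco_criterion (R : realType) (L : choiceType) (w : L -> R) (p : R)
    (pen : {fset L} -> R) (y : L -> R) (m : {fset L}) : R :=
  - (\sum_(l <- m) w l * `|y l| `^ p) + pen m.

Definition pco_selection (R : realType) (L : choiceType) (w : L -> R) (p : R)
    (pen : {fset L} -> R) (M : {fset {fset L}}) (y : L -> R) (m : {fset L}) :
    Prop :=
  m \in M /\
  forall m', m' \in M ->
    pco_criterion w p pen y m <= pco_criterion w p pen y m'.

Definition block_penalty (R : realType) (p sigma kap : R) (n : nat) (x : R)
    : R :=
  3 / 2 * sigma `^ p * n%:R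
  + kap * 2 `^ (Num.max (p - 2) 0 / 2) * n%:R `^ Num.max (1 - p / 2) 0
    * x `^ (p / 2).

Definition penalty (R : realType) (L : choiceType) (J : finType)
    (p eps sigma kap : R) (Lam : J -> {fset L}) (omega : J -> R)
    (x : J -> {fset L} -> R) (m : {fset L}) : R :=
  2 * eps `^ p *
  \sum_(j : J) omega j *
    block_penalty p sigma kap #|` (m `&` Lam j)%fset | (x j (m `&` Lam j)%fset).

Definition traces (L : choiceType) (M : {fset {fset L}}) (B : {fset L})
    : {fset {fset L}} :=
  [fset (m `&` B)%fset | m in M]%fset.

Definition remainder (R : realType) (L : choiceType) (J : finType) (p : R)
    (Lam : J -> {fset L}) (omega : J -> R) (x : J -> {fset L} -> R)
    (M : {fset {fset L}}) : R :=
  \sum_(j : J) omega j *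
    \sum_(mj <- traces M (Lam j) | mj != fset0)
      #|` mj|%:R `^ Num.max (1 - p / 2) 0 * expR (- x j mj).

(* Main.v *)
(* Write Loss(m) = V(m) + B(m), where V(m) is the weighted p-th power of the noise
   over m and B(m) the weighted p-th power of theta off m. Minimality of mhat
   compares the observed energies of mhat and m off their intersection. Turning
   |theta|^p into |Y|^p costs a factor K = 2^p, turning |Y|^p back into noise and
   signal costs only 3/2 on the noise; since K >= 2, the term - K pen(mhat)
   absorbs (1 + 3 K / 2) V(mhat) as soon as V(mhat) <= pen(mhat) / 2, and what is
   left is a multiple of Loss(m) + pen(m). The part of V(mhat) above
   pen(mhat) / 2 is at most the sum of the excesses
   (sum_{l in m_j} |xi_l|^p - p_j(m_j))_+ over all nonempty traces m_j, which does
   not involve mhat any more. By concentration at level x_{m_j} + u, each excess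
   has tail 2 exp(- x_{m_j} - u) at a multiple of |m_j|^{(1 - p/2)_+} u^{p/2}, and
   summing over integer u bounds its expectation by the corresponding term of
   R(M). *)

Require Import Defs.
From HB Require Import structures.
From mathcomp Require Import all_boot all_order all_algebra finmap.
From mathcomp Require Import all_classical all_reals all_analysis.
From mathcomp Require Import measurable_realfun ring lra.

Set Implicit Arguments.
Unset Strict Implicit.
Unset Printing Implicit Defensive.

Import Order.TTheory GRing.Theory Num.Theory.
Import numFieldNormedType.Exports.

Local Open Scope classical_set_scope.
Local Open Scope ring_scope.

(** * Power inequalities for sums of two numbers *)

(** The sum is at most twice the larger term. The constant is crude, but for q >= 1 it is at least
    2, as the absorption of the penalty will require. *)
Lemma powRD_le_max (R : realType) (q a b : R) : 0 <= q -> 0 <= a -> 0 <= b ->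
  (a + b) `^ q <= 2 `^ q * (a `^ q + b `^ q).
Proof.
move=> q0; wlog ab : a b / a <= b => [hw a0 b0|a0 b0].
  case/orP: (le_total a b) => [ab|ba]; first exact: hw.
  by rewrite addrC [X in _ * X]addrC; exact: hw.
have : (a + b) `^ q <= (2 * b) `^ q.
  by apply: ge0_ler_powR; rewrite // ?nnegrE; lra.
rewrite powRM// => /le_trans; apply; rewrite ler_wpM2l ?powR_ge0//.
by rewrite lerDr powR_ge0.
Qed.

(** Two regimes: if b <= e a, the sum is at most (1 + e) a; otherwise a is at most b / e and
    everything is charged to b. With 3/2 in front, K >= 2 suffices in [oracle_deterministic]. *)
Lemma powRD_le_eta (R : realType) (q : R) : 0 < q ->
  exists2 C : R, 0 < C & forall a b : R, 0 <= a -> 0 <= b ->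
    (a + b) `^ q <= 3 / 2 * a `^ q + C * b `^ q.
Proof.
(* [e] is the solution of (1 + e)^q = 3/2. *)
move=> q0; pose e : R := (3 / 2) `^ q^-1 - 1.
have e0 : 0 < e.
  have : 1 `^ q^-1 < (3 / 2) `^ q^-1 :> R.
    by apply: gt0_ltr_powR; rewrite ?invr_gt0 ?nnegrE//; lra.
  by rewrite powR1 subr_gt0.
have eq : (1 + e) `^ q = 3 / 2.
  by rewrite /e subrKC -powRrM mulVf ?gt_eqF// powRr1//; lra.
have ie0 : 0 < e^-1 by rewrite invr_gt0.
exists ((e^-1 + 1) `^ q) => [|a b a0 b0]; first by rewrite powR_gt0; lra.
have [bea|eab] := leP b (e * a).
  apply: (@le_trans _ _ (((1 + e) * a) `^ q)).
    by apply: ge0_ler_powR; rewrite ?nnegrE; nra.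
  by rewrite powRM ?eq; [rewrite lerDl mulr_ge0 ?powR_ge0| lra|].
apply: (@le_trans _ _ (((e^-1 + 1) * b) `^ q)).
  have ab : a <= e^-1 * b by rewrite ler_pdivlMl// ltW.
  by apply: ge0_ler_powR; rewrite ?nnegrE; nra.
by rewrite powRM//; [rewrite lerDr mulr_ge0 ?powR_ge0//; lra | lra].
Qed.

(** For q <= 1, the fractions x / (x + u) and u / (x + u) sum to 1 and each is at most its q-th
    power; for q > 1, this is convexity at the midpoint. With q = p / 2 the constant is the power of
    2 in the penalty. *)
Lemma powRD_le (R : realType) (q x u : R) : 0 < q -> 0 < x -> 0 <= u ->
  (x + u) `^ q <= 2 `^ Num.max (q - 1) 0 * (x `^ q + u `^ q).
Proof.
move=> q0 x0 u0; have xu0 : 0 < x + u by lra.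
have [q1|q1] := leP q 1.
  have -> : Num.max (q - 1) 0 = 0 :> R by apply/max_idPr; lra.
  rewrite powRr0 mul1r.
  have h (y : R) : 0 <= y -> y <= x + u -> y / (x + u) * (x + u) `^ q <= y `^ q.
    rewrite le_eqVlt => /predU1P[<- _|y0 yxu]; first by rewrite !mul0r powR_ge0.
    have yp : 0 < y / (x + u) by rewrite divr_gt0.
    rewrite -[X in _ <= X `^ q](divfK (lt0r_neq0 xu0)).
    rewrite (powRM _ (ltW yp) (ltW xu0)) ler_wpM2r ?powR_ge0// ger1_powR//.
    by rewrite yp/= ler_pdivrMr// mul1r.
  apply: le_trans (lerD (h x _ _) (h u _ _)); try lra.
  by rewrite -mulrDl -mulrDl divff ?gt_eqF// mul1r.
have -> : Num.max (q - 1) 0 = q - 1 :> R by apply/max_idPl; lra.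
have h2 : 0 <= (2^-1 : R) <= 1 by lra.
have := @convex_powR R q (ltW q1) (Itv01 (proj1 (andP h2)) (proj2 (andP h2))) x u.
rewrite !inE/= !in_itv/= (ltW x0) u0 => /(_ isT isT).
rewrite [X in X `^ _ <= _ -> _]convRE [X in _ <= X -> _]convRE/= /unstable.onem.
have -> : 2^-1 * x + (1 - 2^-1) * u = 2^-1 * (x + u) by lra.
have -> : 1 - 2^-1 = 2^-1 :> R by lra.
rewrite powRM//; last by lra.
rewrite -mulrDr -powR_inv1// -powRrM mulN1r => h.
rewrite -(ler_pM2l (powR_gt0 (- q) (ltr0Sn R 1))).
apply: (le_trans h); rewrite mulrA -powRD; last by rewrite pnatr_eq0 implybT.
by have -> : - q + (q - 1) = -1 by ring.
Qed.

(** * Expectations of positive parts from exponential tails *)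

(* The selected set [mhat] is not assumed measurable, so the loss of the PCO
   estimator can only be compared through the definition of the integral. *)
Lemma ge0_le_integral_nonmeasurable d (T : measurableType d) (R : realType)
    (mu : {measure set T -> \bar R}) (f g : T -> \bar R) :
  (forall o, 0 <= f o)%E -> (forall o, f o <= g o)%E ->
  (\int[mu]_o f o <= \int[mu]_o g o)%E.
Proof.
move=> f0 fg; have g0 o : (0 <= g o)%E by exact: le_trans (fg o).
rewrite !ge0_integralTE//; apply: le_ereal_sup => _ [h hf <-].
by exists h => // o; exact: le_trans (fg o).
Qed.

(** Sum over n of (2 q)^q exp((n + 1) / 2) exp(- n), a geometric series of ratio exp(- 1/2). *)
Definition peeling_const (R : realType) (q : R) : R :=
  (2 * q) `^ q * expR (1 / 2) / (1 - expR (- (1 / 2))).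

Lemma peeling_const_gt0 (R : realType) (q : R) : 0 < q -> 0 < peeling_const q.
Proof.
move=> q0; rewrite divr_gt0 ?mulr_gt0 ?powR_gt0 ?expR_gt0 ?subr_gt0 ?expR_lt1//; lra.
Qed.

(** Raise v <= exp(v), with v = u / (2 q), to the power q. The rate 1/2 is below the rate 1 of the
    tails, so the peeling series converges. *)
Lemma powR_le_expR_half (R : realType) (q u : R) : 0 < q -> 0 <= u ->
  u `^ q <= (2 * q) `^ q * expR (u / 2).
Proof.
move=> q0 u0; have q20 : 0 < 2 * q by lra.
have uE : u = (2 * q) * (u / (2 * q)) by rewrite mulrC divfK// gt_eqF.
rewrite {1}uE powRM ?divr_ge0 ?(ltW q20)// ler_wpM2l ?powR_ge0//.
have -> : u / 2 = u / (2 * q) * q by field; rewrite gt_eqF.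
rewrite expRM ge0_ler_powR ?nnegrE ?(ltW q0) ?expR_ge0 ?divr_ge0 ?(ltW q20)//.
by apply: le_trans (expR_ge1Dx _); rewrite lerDr.
Qed.

(* If [s = K * u `^ q] with [u >= 0], the term of index [n], the integer part of
   [u], already dominates [s]. *)
Lemma excess_le_peeling (R : realType) (q K s : R) : 0 < q -> 0 < K ->
  ((Num.max s 0)%:E <= \sum_(0 <= n <oo)
    ((K * (2 * q) `^ q * expR ((n%:R + 1) / 2))
      * (K * n%:R `^ q <= s)%R%:R)%:E)%E.
Proof.
move=> q0 K0; pose f n : \bar R := ((K * (2 * q) `^ q * expR ((n%:R + 1) / 2))
  * (K * n%:R `^ q <= s)%R%:R)%:E.
have f0 n : (0 <= f n)%E.
  by rewrite /f lee_fin !mulr_ge0 ?powR_ge0 ?expR_ge0 ?(ltW K0).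
have [s0|s0] := leP s 0; first by apply: nneseries_ge0 => n _ _; exact: f0.
pose u := (s / K) `^ q^-1; have u0 : 0 <= u by rewrite powR_ge0.
have sE : s = K * u `^ q.
  rewrite /u -powRrM mulVf ?gt_eqF// powRr1 ?divr_ge0 ?ltW//.
  by rewrite mulrC divfK ?gt_eqF.
have /andP[nu un] := truncn_itv u0; set n := Num.trunc u in nu un.
apply: le_trans (nneseries_lim_ge n.+1 (fun n _ _ => f0 n)).
rewrite big_nat_recr//= /f; apply: le_trans (leeDr _ _); last by apply: sume_ge0 => i _; exact: f0.
have -> : K * n%:R `^ q <= s.
  rewrite sE ler_pM2l//; apply: ge0_ler_powR; rewrite ?nnegrE//; exact: ltW.
rewrite lee_fin mulr1 {1}sE -mulrA ler_pM2l//; apply: le_trans (powR_le_expR_half q0 u0) _.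
rewrite ler_wpM2l ?powR_ge0// ler_expR ler_wpM2r ?invr_ge0//.
by rewrite natr1 ltW.
Qed.

(** When the pointwise series of [excess_le_peeling] is integrated term by term, weights of order
    exp(n / 2) meet tails of order exp(- n), which leaves the geometric series summed in
    [peeling_const]. *)
Lemma integral_excess_le (R : realType) d (T : measurableType d)
    (P : probability T R) (S : T -> R) (q K b A : R) :
  measurable_fun setT S -> 0 < q -> 0 < K -> 0 <= A ->
  (forall u : R, 0 <= u ->
    (P [set o | (b + K * u `^ q <= S o)%R] <= (A * expR (- u))%:E)%E) ->
  (\int[P]_o (Num.max (S o - b) 0)%:E <= (K * peeling_const q * A)%:E)%E.
Proof.
move=> mS q0 K0 A0 tail.
pose E n := [set o | b + K * n%:R `^ q <= S o].
have mE n : measurable (E n).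
  by rewrite -[E n]setTI; apply: measurable_fun_le.
pose c n : R := K * (2 * q) `^ q * expR ((n%:R + 1) / 2).
have c0 n : 0 <= c n by rewrite !mulr_ge0 ?powR_ge0 ?expR_ge0 ?(ltW K0).
pose rho : R := expR (- (1 / 2)).
have rho1 : rho < 1 by rewrite expR_lt1; lra.
pose c' : R := K * (2 * q) `^ q * expR (1 / 2) * A.
have c'0 : 0 <= c' by rewrite !mulr_ge0 ?powR_ge0 ?expR_ge0 ?(ltW K0).
apply: (@le_trans _ _ (\int[P]_o \sum_(0 <= n <oo) (c n * \1_(E n) o)%:E)%E).
  apply: ge0_le_integral_nonmeasurable => o.
    by rewrite lee_fin le_max lexx orbT.
  apply: le_trans (excess_le_peeling _ q0 K0) _; apply: lee_nneseries => n _.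
    by rewrite lee_fin mulr_ge0// c0.
  rewrite indicE lee_fin ler_wpM2l//; first exact: c0.
  rewrite lerBrDl ler_nat; have [h|//] := leP; by rewrite mem_set.
rewrite (@integral_nneseries _ _ _ P _ measurableT
  (fun n o => (c n * \1_(E n) o)%:E))//; last 2 first.
- move=> n; apply/measurable_EFinP; apply: measurable_funM => //.
- by move=> n o _; rewrite lee_fin mulr_ge0.
apply: (@le_trans _ _ (\sum_(0 <= n <oo) (geometric c' rho n)%:E)%E).
  apply: lee_nneseries => n _.
    by move=> _; apply: integral_ge0 => o _; rewrite lee_fin mulr_ge0.
  under eq_integral do rewrite EFinM.
  rewrite ge0_integralZl//=; last 2 first.
  - exact/measurable_EFinP.
  - by rewrite lee_fin.
  rewrite integral_indic// setIT.
  have cn0 : (0 <= (c n)%:E)%E by rewrite lee_fin.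
  apply: le_trans (lee_wpmul2l cn0 (tail n%:R (ler0n _ _))) _.
  rewrite -EFinM lee_fin /= /c /c' /rho -expRM_natl.
  have e : expR ((n%:R + 1) / 2) * expR (- n%:R)
      = expR (1 / 2) * expR (n%:R * - (1 / 2)) :> R.
    by rewrite -!expRD; congr expR; field.
  rewrite le_eqVlt; apply/orP; left; apply/eqP.
  transitivity (K * (2 * q) `^ q * A * (expR ((n%:R + 1) / 2) * expR (- n%:R))).
    by ring.
  by rewrite e; ring.
apply: lime_le; first by apply: is_cvg_nneseries => n _ _; rewrite lee_fin geometric_ge0 ?expR_ge0.
near=> n; rewrite sumEFin lee_fin.
have -> : K * peeling_const q * A = c' / (1 - rho).
  by rewrite /peeling_const /c'; ring.
apply: geometric_le_lim; rewrite ?expR_gt0// ger0_norm// expR_ge0.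
Unshelve. all: by end_near.
Qed.

(** * Concentration of power sums of the noise *)

(** [concentration_constants] concerns families indexed by a finite type; this carries the
    hypotheses on [xi] over to the subfamily indexed by the elements of a finite set. *)
Lemma subgaussian_iid_comp (R : realType) d (T : measurableType d)
    (P : probability T R) (I I' : choiceType) (h : I' -> I)
    (xi : I -> {RV P >-> R}) :
  injective h -> subgaussian_iid xi ->
  subgaussian_iid (fun i : I' => xi (h i)).
Proof.
move=> hinj [ind idd cent tail]; split => //; last by move=> i; exact: tail.
  move=> F B mB.
  (* Independence is only used on the image of [h]; elsewhere [setT] is a measurable default. *)
  pose B' (l : I) : set R := match pselect (exists i, h i = l) with
    | left e => B (projT1 (cid e)) | right _ => setT end.
  have B'h i : B' (h i) = B i.
    rewrite /B'; case: pselect => [e|]; last by case; exists i.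
    by case: (cid e) => /= i' /hinj ->.
  have mB' l : measurable (B' l) by rewrite /B'; case: pselect.
  have := ind (h @` F)%fset B' mB'.
  rewrite big_imfset/=; last by move=> ? ? _ _ /hinj.
  under eq_bigr do rewrite B'h; move=> <-; congr (P _).
  apply/seteqP; split => o /= H i.
    by move=> /imfsetP[j /= jF ->]; rewrite B'h; exact: H.
  by move=> iF; rewrite -B'h; apply: H; rewrite /= in_imfset.
by move=> i j B mB; exact: idd.
Qed.

Lemma max_half (R : realType) (p : R) :
  Num.max (p - 2) 0 / 2 = Num.max (p / 2 - 1) 0.
Proof.
have [h|h] := leP (p - 2) 0; have [h'|h'] := leP (p / 2 - 1) 0; lra.
Qed.

Lemma kappa_gt0 (R : realType) (p c1 c2 sigma : R) :
  0 < c1 -> 0 < c2 -> 0 < kappa p c1 c2 sigma.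
Proof.
move=> c10 c20; rewrite addr_gt0// mulr_gt0//.
by rewrite lt_max ltr01.
Qed.

(* AM-GM suffices when [2 <= p] or [y <= D], for then [y] is at most
   [D `^ Num.max (1 - p / 2) 0 * y `^ (p / 2)]; when [p < 2] and [D < y], the
   latter dominates [sqrt (D * y)] because [1 <= p]. *)
Lemma deviation_le_kappa (R : realType) (p c1 c2 sigma D y : R) :
  1 <= p -> 0 < c1 -> 0 < c2 -> 0 < sigma -> 1 <= D -> 1 <= y ->
  c1 * Num.sqrt (D * y) + c2 * D `^ Num.max (1 - p / 2) 0 * y `^ (p / 2)
  <= sigma `^ p * D / 2
     + kappa p c1 c2 sigma * D `^ Num.max (1 - p / 2) 0 * y `^ (p / 2).
Proof.
move=> p1 c10 c20 s0 D1 y1; have sp0 : 0 < sigma `^ p by rewrite powR_gt0.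
set m := Num.max (1 - p / 2) 0; set s := sigma `^ p in sp0 *.
set W := D `^ m * y `^ (p / 2).
have W0 : 0 <= W by rewrite mulr_ge0 ?powR_ge0.
have D0 : 0 < D by lra.
have y0 : 0 < y by lra.
suff : c1 * Num.sqrt (D * y) <= s * D / 2 + c1 * Num.max 1 (c1 / (2 * s)) * W.
  by rewrite /kappa -/s -![_ * D `^ m * _]mulrA -/W => H; lra.
set r := Num.sqrt (D * y).
have r0 : 0 <= r by rewrite sqrtr_ge0.
have r2 : r ^+ 2 = D * y by rewrite sqr_sqrtr// mulr_ge0 ?ltW.
have M1 : 1 <= Num.max 1 (c1 / (2 * s)) by rewrite le_max lexx.
have M2 : c1 / (2 * s) <= Num.max 1 (c1 / (2 * s)) by rewrite le_max lexx orbT.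
set Mx := Num.max _ _ in M1 M2 *.
have [yW|rW] : y <= W \/ r <= W.
- have [p2|p2] := leP 2 p.
    left; rewrite /W /m; have -> : Num.max (1 - p / 2) 0 = 0 :> R.
      by apply/max_idPr; lra.
    by rewrite powRr0 mul1r le1r_powR//; lra.
  have mE : m = 1 - p / 2 by apply/max_idPl; lra.
  rewrite /W mE; have [yD|Dy] := leP y D; [left|right].
    apply: (@le_trans _ _ (y `^ (1 - p / 2) * y `^ (p / 2))).
      by rewrite -powRD ?(lt0r_neq0 y0) ?implybT// subrK powRr1// ltW.
    rewrite ler_wpM2r ?powR_ge0//; apply: ge0_ler_powR; rewrite ?nnegrE//; lra.
  rewrite /r sqrtrM ?(ltW D0)// -!powR12_sqrt ?(ltW D0) ?(ltW y0)//.
  have -> : D `^ 2^-1 = D `^ (1 - p / 2) * D `^ (p / 2 - 2^-1).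
    rewrite -powRD ?(lt0r_neq0 D0) ?implybT//; congr (_ `^ _); lra.
  rewrite -mulrA ler_wpM2l ?powR_ge0//.
  apply: (@le_trans _ _ (y `^ (p / 2 - 2^-1) * y `^ 2^-1)).
    rewrite ler_wpM2r ?powR_ge0//; apply: ge0_ler_powR; rewrite ?nnegrE//; lra.
  by rewrite -powRD ?(lt0r_neq0 y0) ?implybT// subrK.
- have amgm : c1 * r <= s * D / 2 + c1 * (c1 / (2 * s)) * y.
    have e : 2 * s * D * (s * D / 2 + c1 * (c1 / (2 * s)) * y - c1 * r)
        = (s * D - c1 * r) ^+ 2.
      transitivity ((s * D) ^+ 2 - 2 * (s * D) * (c1 * r) + c1 ^+ 2 * (D * y)).
        by field; rewrite gt_eqF.
      by rewrite -r2; ring.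
    have sD0 : 0 < 2 * s * D by rewrite !mulr_gt0.
    by rewrite -subr_ge0 -(pmulr_rge0 _ sD0) e sqr_ge0.
  apply: (le_trans amgm); rewrite lerD2l.
  by apply: ler_pM => //; [rewrite mulr_ge0 ?divr_ge0 ?ltW//; lra|lra|rewrite ler_pM2l].
- apply: (@le_trans _ _ (c1 * Mx * W)); last by rewrite lerDr divr_ge0// mulr_ge0 ?ltW.
  rewrite -mulrA ler_pM2l//; apply: (le_trans rW).
  by rewrite ler_peMl.
Qed.

Lemma measurable_power_sum (R : realType) d (T : measurableType d)
    (P : probability T R) (I : choiceType) (xi : I -> {RV P >-> R}) (p : R)
    (m : {fset I}) :
  measurable_fun setT (fun o => \sum_(l <- m) `|xi l o| `^ p).
Proof.
apply: measurable_sum => l.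
apply: (@measurableT_comp _ _ _ _ _ _ (fun r : R => r `^ p)).
  exact: measurable_powR.
exact: (@measurableT_comp _ _ _ _ _ _ (@Num.norm R R)).
Qed.

(** The power sum has mean sigma^p D, and [deviation_le_kappa] bounds the deviation by a further
    sigma^p D / 2 plus the [kappa] term, whence 3/2. The event thus lies in that of the
    concentration inequality. *)
Lemma power_sum_tail (R : realType) d (T : measurableType d)
    (P : probability T R) (I : choiceType) (xi : I -> {RV P >-> R})
    (p c1 c2 sigma : R) (m : {fset I}) (y : R) :
  1 <= p -> 0 < c1 -> 0 < c2 -> concentration_constants p c1 c2 ->
  0 < sigma -> subgaussian_iid xi ->
  (forall l, 'N[P]_p%:E[EFin \o xi l]%E = sigma%:E) ->
  m != fset0 -> 1 <= y ->
  (P [set o | (3 / 2 * sigma `^ p * #|` m|%:R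
      + kappa p c1 c2 sigma * #|` m|%:R `^ Num.max (1 - p / 2) 0 * y `^ (p / 2)
      <= \sum_(l <- m) `|xi l o| `^ p)%R]
   <= (2 * expR (- y))%:E)%E.
Proof.
move=> p1 c10 c20 conc s0 iid nrm m0 y1.
have D0 : (0 < #|` m|)%N by rewrite cardfs_gt0.
have D1 : 1 <= #|` m|%:R :> R by rewrite ler1n.
have y0 : 0 < y by lra.
have := conc d T P m (fun i => xi (val i)) sigma.
rewrite -cardfE => /(_ D0 (subgaussian_iid_comp val_inj iid)).
move=> /(_ (fun i => nrm (val i)) y y0) /=; apply: le_trans.
have mS := measurable_power_sum xi p m.
apply: le_measure; rewrite ?inE.
- by rewrite -[X in measurable X]setTI; apply: measurable_fun_le.
- rewrite -[X in measurable X]setTI; apply: measurable_fun_le => //.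
  apply: (@measurableT_comp _ _ _ _ _ _ (@Num.norm R R)) => //.
  apply: measurable_funB => //.
  by under eq_fun do rewrite -(big_seq_fsetE _ _ xpredT (fun l => `|xi l _| `^ p)).
move=> o /= H.
rewrite -(big_seq_fsetE _ _ xpredT (fun l => `|xi l o| `^ p)).
apply: le_trans (ler_norm _).
have := deviation_le_kappa p1 c10 c20 s0 D1 y1; lra.
Qed.

(** The last factor 2 comes from the tail 2 exp(- y); the power of the cardinality is left to
    [remainder]. *)
Definition excess_const (R : realType) (p c1 c2 sigma : R) : R :=
  kappa p c1 c2 sigma * 2 `^ (Num.max (p - 2) 0 / 2) * peeling_const (p / 2) * 2.

(** Concentration is used at level x + u with u free. By [powRD_le], the part of (x + u)^(p / 2) due
    to x is paid by the block penalty, and the part due to u feeds [integral_excess_le]. *)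
Lemma power_sum_excess (R : realType) d (T : measurableType d)
    (P : probability T R) (I : choiceType) (xi : I -> {RV P >-> R})
    (p c1 c2 sigma : R) (m : {fset I}) (x : R) :
  1 <= p -> 0 < c1 -> 0 < c2 -> concentration_constants p c1 c2 ->
  0 < sigma -> subgaussian_iid xi ->
  (forall l, 'N[P]_p%:E[EFin \o xi l]%E = sigma%:E) ->
  m != fset0 -> 1 <= x ->
  (\int[P]_o (Num.max (\sum_(l <- m) `|xi l o| `^ p
     - block_penalty p sigma (kappa p c1 c2 sigma) #|` m| x) 0)%:E
   <= (excess_const p c1 c2 sigma
       * (#|` m|%:R `^ Num.max (1 - p / 2) 0 * expR (- x)))%:E)%E.
Proof.
move=> p1 c10 c20 conc s0 iid nrm m0 x1.
have D0 : (0 < #|` m|)%N by rewrite cardfs_gt0.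
have k0 := kappa_gt0 p sigma c10 c20.
set Da := _ `^ Num.max _ _; have Da0 : 0 < Da by rewrite powR_gt0// ltr0n.
have x0 : 0 < x by lra.
have q0 : 0 < p / 2 by lra.
set k := kappa _ _ _ _ in k0 *; set t := 2 `^ (Num.max (p - 2) 0 / 2).
have t0 : 0 < t by rewrite powR_gt0.
(* Regrouped as scale, peeling constant and tail factor, the shape of [integral_excess_le]. *)
have -> : excess_const p c1 c2 sigma * (Da * expR (- x))
    = k * t * Da * peeling_const (p / 2) * (2 * expR (- x)).
  by rewrite /excess_const -/k -/t; ring.
apply: integral_excess_le => //; first exact: measurable_power_sum.
  by rewrite !mulr_gt0.
move=> u u0.
have xu1 : 1 <= x + u by lra.
have := power_sum_tail p1 c10 c20 conc s0 iid nrm m0 xu1.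
rewrite -/k -/Da opprD expRD mulrA; apply: le_trans.
have mS := measurable_power_sum xi p m.
apply: le_measure; rewrite ?inE.
- by rewrite -[X in measurable X]setTI; apply: measurable_fun_le.
- by rewrite -[X in measurable X]setTI; apply: measurable_fun_le.
move=> o /= H; apply: le_trans H; rewrite /block_penalty -/t -/Da -addrA lerD2l.
have h := powRD_le q0 x0 u0.
rewrite -max_half -/t in h.
have := ler_wpM2l (ltW (mulr_gt0 k0 Da0)) h; lra.
Qed.

(** * Sums over finite sets, and the loss as noise plus bias *)

(** Puts sums over different finite sets on a common index set, so that they can be compared term by
    term. *)
Lemma sum_fset_mask (R : nmodType) (I : choiceType) (A U : {fset I})
    (f : I -> R) : (A `<=` U)%fset ->
  \sum_(l <- A) f l = \sum_(l <- U) (if l \in A then f l else 0).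
Proof.
move=> AU; rewrite -(big_fset_incl _ AU) => [|l _ /negPf ->//].
by apply: eq_big_seq => l ->.
Qed.

Lemma esum_split_fset (R : realType) (I : choiceType) (f : I -> R)
    (m : {fset I}) : (forall l, 0 <= f l) ->
  (\esum_(l in [set: I]) (f l)%:E
   = (\sum_(l <- m) f l)%:E + \esum_(l in ~` [set` m]) (f l)%:E)%E.
Proof.
move=> f0; rewrite (esumID [set` m]); last by move=> l _; rewrite lee_fin.
rewrite !setTI; congr (_ + _)%E; rewrite esum_fset//; last first.
  by move=> l _; rewrite lee_fin.
by rewrite fsbig_finite// set_fsetK sumEFin.
Qed.

(** Finiteness of the total makes the part off [m] a real number, so that the bias can be handled by
    real arithmetic. *)
Lemma esum_lt_pinfty_fset (R : realType) (I : choiceType) (f : I -> R)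
    (m : {fset I}) : (forall l, 0 <= f l) ->
  (\esum_(l in [set: I]) (f l)%:E < +oo)%E ->
  let t := fine (\esum_(l in [set: I]) (f l)%:E)%E in
  \sum_(l <- m) f l <= t /\
  (\esum_(l in ~` [set` m]) (f l)%:E = (t - \sum_(l <- m) f l)%:E)%E.
Proof.
move=> f0; rewrite (esum_split_fset m f0).
have : (0 <= \esum_(l in ~` [set` m]) (f l)%:E)%E.
  by apply: esum_ge0 => l _; rewrite lee_fin.
case: (\esum_(l in _) _) => [r| |]//; rewrite lee_fin => r0 _ /=.
by rewrite lerDl addrAC subrr add0r.
Qed.

(** On [m] the error is the noise [z]; off [m] it is the opposite of [theta]. *)
Lemma lp_loss_proj (R : realType) (L : choiceType) (w : L -> R) (p : R)
    (theta z : L -> R) (m : {fset L}) :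
  (forall l, 0 <= w l) -> (lp_loss w p theta < +oo)%E ->
  (lp_loss w p (fun l => proj_estimator (fun l => theta l + z l) m l - theta l)%R
   = (\sum_(l <- m) w l * `|z l| `^ p
      + (fine (lp_loss w p theta) - \sum_(l <- m) w l * `|theta l| `^ p))%:E)%E.
Proof.
move=> w0 fin.
have b0 l : 0 <= w l * `|theta l| `^ p by rewrite mulr_ge0 ?powR_ge0.
have [_ E] := esum_lt_pinfty_fset m b0 fin.
rewrite /lp_loss EFinD -E.
rewrite (esum_split_fset m); last by move=> l; rewrite mulr_ge0 ?powR_ge0.
congr (_%:E + _)%E.
  by apply: eq_big_seq => l lm; rewrite /proj_estimator lm addrAC subrr add0r.
apply: eq_esum => l /= /negP/negPf lm.
by rewrite /proj_estimator lm sub0r normrN.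
Qed.

(** * The oracle inequality at a fixed outcome *)

(** [b], [v] and [y] stand for the weighted p-th powers of signal, noise and observation, [t] for
    the total signal, [h] for the selected set and [m] for its competitor. *)
Lemma oracle_deterministic (R : realType) (L : choiceType) (b v y : L -> R)
    (K C t penm penh rem : R) (m h : {fset L}) :
  2 <= K -> 0 <= C -> 0 <= rem -> 0 <= penm -> 0 <= penh ->
  (forall l, 0 <= b l) -> (forall l, 0 <= v l) ->
  (forall l, b l <= K * (y l + v l)) ->
  (forall l, y l <= 3 / 2 * v l + C * b l) ->
  (forall U : {fset L}, \sum_(l <- U) b l <= t) ->
  - \sum_(l <- h) y l + penh <= - \sum_(l <- m) y l + penm ->
  \sum_(l <- h) v l <= penh / 2 + rem ->
  \sum_(l <- h) v l + (t - \sum_(l <- h) b l)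
  <= (1 + K * C + K) * (\sum_(l <- m) v l + (t - \sum_(l <- m) b l) + penm)
     + (1 + 3 / 2 * K) * rem.
Proof.
move=> K2 C0 rem0 pm0 ph0 b0 v0 bK yC tU crit vh.
set U := (m `|` h)%fset.
have mU : (m `<=` U)%fset by rewrite fsubsetUl.
have hU : (h `<=` U)%fset by rewrite fsubsetUr.
have Vm0 : 0 <= \sum_(l <- m) v l by rewrite sumr_ge0.
(* Checked index by index: on [m] minus [h] the signal is bounded by [bK], on [h] minus [m] the
   observation by [yC], and elsewhere the left side vanishes. *)
have key : \sum_(l <- m) b l - \sum_(l <- h) b l
    + K * (\sum_(l <- h) y l - \sum_(l <- m) y l)
  <= K * \sum_(l <- m) v l + 3 / 2 * K * \sum_(l <- h) v l
     + K * C * (\sum_(l <- U) b l - \sum_(l <- m) b l).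
  rewrite !(sum_fset_mask _ mU) !(sum_fset_mask _ hU) -!sumrB !mulr_sumr.
  rewrite -!big_split /=; apply: ler_sum => l _.
  have K0 : 0 <= K by lra.
  have Kv0 : 0 <= K * v l by rewrite mulr_ge0.
  have KCb0 : 0 <= K * C * b l by rewrite !mulr_ge0.
  have Kyc := ler_wpM2l K0 (yC l).
  have := bK l; have := b0 l.
  case: (l \in m); case: (l \in h) => b0l bk; lra.
(* Adding the signal off [U] bounds the signal on [U] minus [m] by the whole bias of [m]. *)
have hU' : 0 <= K * C * (t - \sum_(l <- U) b l).
  by rewrite !mulr_ge0 ?subr_ge0//; lra.
have K0 : 0 <= K by lra.
have B0 : 0 <= t - \sum_(l <- m) b l by rewrite subr_ge0.
have KB := mulr_ge0 K0 B0.
have KCV : 0 <= K * C * \sum_(l <- m) v l by rewrite !mulr_ge0.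
have KCp : 0 <= K * C * penm by rewrite !mulr_ge0.
(* The margin left on [penh] is K - (1 + 3 K / 2) / 2 = (K - 2) / 4, nonnegative exactly when K >=
   2. *)
have Kp : 0 <= (K - 2) * penh by rewrite mulr_ge0// subr_ge0.
have Kcrit := ler_wpM2l K0 crit.
have Kvh : (1 + 3 / 2 * K) * \sum_(l <- h) v l
    <= (1 + 3 / 2 * K) * (penh / 2 + rem) by apply: ler_wpM2l => //; lra.
lra.
Qed.

(** * Decomposition along the weight levels *)

Lemma block_penalty_ge0 (R : realType) (p sigma kap : R) (n : nat) (x : R) :
  0 <= kap -> 0 <= block_penalty p sigma kap n x.
Proof.
move=> k0; rewrite /block_penalty addr_ge0 ?mulr_ge0 ?powR_ge0//; lra.
Qed.

Lemma level_partition_ge0 (R : realType) (L : choiceType) (A : set L)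
    (w : L -> R) (J : finType) (Lam : J -> {fset L}) (omega : J -> R) j :
  level_partition A w Lam omega -> (forall l, 0 <= w l) -> 0 <= omega j.
Proof.
by move=> [_ /(_ j)/fset0Pn[l lj] /(_ _ _ lj) <- _]; exact.
Qed.

(** Injectivity of [omega] makes the block of an index unique, so only one block contributes for
    each [l]. *)
Lemma sum_level_partition (R : realType) (L : choiceType) (A : set L)
    (w : L -> R) (J : finType) (Lam : J -> {fset L}) (omega : J -> R)
    (f : L -> R) (m : {fset L}) :
  level_partition A w Lam omega -> [set` m] `<=` A ->
  \sum_(l <- m) w l * f l
  = \sum_j omega j * \sum_(l <- (m `&` Lam j)%fset) f l.
Proof.
move=> [-> _ wE oinj] mA.
under [RHS]eq_bigr do rewrite (sum_fset_mask _ (fsubsetIl m _)) mulr_sumr.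
rewrite exchange_big /=; apply: eq_big_seq => l lm.
have [j _ lj] := mA _ lm.
rewrite (bigD1 j)//= in_fsetI lm lj/= big1 ?addr0 ?(wE _ _ lj)// => i ij.
rewrite in_fsetI lm/=; case: ifPn => [li|]; last by rewrite mulr0.
by rewrite (oinj i j) ?eqxx// -?(wE _ _ li) -?(wE _ _ lj) in ij.
Qed.

(** Applied twice: to the sum over blocks, then to the sum over the traces in a block. *)
Lemma integral_sum_le (R : realType) d (T : measurableType d)
    (P : probability T R) (I : eqType) (s : seq I) (Q : pred I)
    (g : I -> T -> R) (c e : I -> R) :
  (forall i, measurable_fun setT (g i)) -> (forall i o, 0 <= g i o) ->
  (forall i, 0 <= c i) ->
  (forall i, i \in s -> Q i -> (\int[P]_o (g i o)%:E <= (e i)%:E)%E) ->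
  (\int[P]_o (\sum_(i <- s | Q i) c i * g i o)%:E
   <= (\sum_(i <- s | Q i) c i * e i)%:E)%E.
Proof.
move=> mg g0 c0 ge; rewrite -big_filter.
under eq_integral do rewrite -big_filter -sumEFin.
rewrite (ge0_integral_sum P measurableT (f := fun i o => (c i * g i o)%:E)).
- rewrite -sumEFin !big_seq; apply: lee_sum => i.
  rewrite mem_filter => /andP[Qi si].
  under eq_integral do rewrite EFinM.
  rewrite ge0_integralZl ?lee_fin//.
  + by rewrite EFinM; apply: lee_wpmul2l; [rewrite lee_fin|exact: ge].
  + exact/measurable_EFinP.
  + by move=> o _; rewrite lee_fin.
- by move=> i; apply/measurable_EFinP; exact: measurable_funM.
- by move=> i o _; rewrite lee_fin mulr_ge0.
Qed.

(* The factor [1] gives the inner sum the shape required by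
   [integral_sum_le]. *)
Definition noise_excess (R : realType) (L : choiceType) (J : finType) (T : Type)
    (p eps sigma kap : R) (Lam : J -> {fset L}) (omega : J -> R)
    (x : J -> {fset L} -> R) (M : {fset {fset L}}) (xi : L -> T -> R) (o : T)
    : R :=
  \sum_(j : J) (eps `^ p * omega j) *
    \sum_(mj <- traces M (Lam j) | mj != fset0)
      1 * Num.max (\sum_(l <- mj) `|xi l o| `^ p
                   - block_penalty p sigma kap #|` mj| (x j mj)) 0.

(** In each block the noise over the trace of [m] exceeds the block penalty by at most a positive
    part, which is one of the nonnegative terms summed in [noise_excess]. An empty trace carries no
    noise. *)
Lemma noise_le_penalty (R : realType) (L : choiceType) (J : finType)
    (p eps sigma kap : R) (A : set L) (w : L -> R) (Lam : J -> {fset L})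
    (omega : J -> R) (x : J -> {fset L} -> R) (M : {fset {fset L}}) (T : Type)
    (xi : L -> T -> R) (o : T) (m : {fset L}) :
  0 < eps -> 0 <= kap -> level_partition A w Lam omega ->
  (forall l, 0 <= w l) -> [set` m] `<=` A -> m \in M ->
  \sum_(l <- m) w l * `|eps * xi l o| `^ p
  <= penalty p eps sigma kap Lam omega x m / 2
     + noise_excess p eps sigma kap Lam omega x M xi o.
Proof.
move=> e0 k0 part w0 mA mM; have om0 j := level_partition_ge0 j part w0.
rewrite (sum_level_partition _ part mA) /penalty /noise_excess.
(* The half cancels the factor 2 of [penalty], leaving one block penalty per block. *)
rewrite mulrAC -[2 * eps `^ p]mulrC mulfK// mulr_sumr -big_split/=.
apply: ler_sum => j _; rewrite mulrA -mulrDr.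
under eq_bigr do rewrite normrM (gtr0_norm e0) powRM ?(ltW e0)//.
rewrite -mulr_sumr mulrA [omega j * _]mulrC ler_wpM2l ?mulr_ge0 ?powR_ge0//.
set mj := (m `&` Lam j)%fset.
have mjT : mj \in traces M (Lam j) by apply/imfsetP; exists m.
have [mj0|mj0] := eqVneq mj fset0.
  rewrite {1}mj0 big_seq_fset0 addr_ge0 ?block_penalty_ge0//.
  by apply: sumr_ge0 => i _; rewrite mul1r le_max lexx orbT.
rewrite -lerBlDl [leRHS]big_mkcond [leRHS](big_fsetD1 mj)//= mj0 mul1r -[X in X <= _]addr0 lerD//.
  by rewrite le_max lexx.
apply: sumr_ge0 => i _; case: ifP => // _.
by rewrite mul1r le_max lexx orbT.
Qed.

(** * The oracle inequality in expectation *)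

Theorem theorem2p5 (R : realType) (p c1 c2 sigma : R)
    (p_ge1 : 1 <= p) (c1_gt0 : 0 < c1) (c2_gt0 : 0 < c2)
    (c12P : concentration_constants p c1 c2) (sigma_gt0 : 0 < sigma) :
  exists Mt Mb : R, 0 < Mt /\ 0 < Mb /\
  forall (L : countType) (rk : L -> nat) (N : nat) (eps : R) (theta w : L -> R)
    (d : measure_display) (T : measurableType d) (P : probability T R)
    (xi : L -> {RV P >-> R})
    (J : finType) (Lam : J -> {fset L}) (omega : J -> R)
    (M : {fset {fset L}}) (x : J -> {fset L} -> R) (mhat : T -> {fset L}),
  let Y : T -> L -> R := observation theta eps xi in
  let pen : {fset L} -> R :=
    penalty p eps sigma (kappa p c1 c2 sigma) Lam omega x in
  let risk (est : T -> L -> R) : \bar R :=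
    (\int[P]_o lp_loss w p (fun l => (est o l - theta l)%R))%E in
  enumeration rk ->
  0 < eps -> eps <= 1 ->
  subgaussian_iid xi ->
  (forall l, 'N[P]_p%:E[EFin \o xi l]%E = sigma%:E) ->
  (forall l, 0 <= w l) ->
  (lp_loss w p theta < +oo)%E ->
  level_partition (first_elements rk N) w Lam omega ->
  M != fset0 ->
  (forall m, m \in M -> [set` m] `<=` first_elements rk N) ->
  (forall j mj, mj \in traces M (Lam j) -> 1 <= x j mj) ->
  (forall o, pco_selection w p pen M (Y o) (mhat o)) ->
  (risk (fun o => proj_estimator (Y o) (mhat o))
   <= Mt%:E * ereal_inf [set (risk (fun o => proj_estimator (Y o) m)
                              + (pen m)%:E) | m in [set` M]]
      + (Mb * eps `^ p * remainder p Lam omega x M)%:E)%E.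
Proof.
have p0 : 0 < p by lra.
have [C C0 powC] := powRD_le_eta p0.
pose K : R := 2 `^ p.
have K2 : 2 <= K by apply: le1r_powR => //; lra.
have k0 := kappa_gt0 p sigma c1_gt0 c2_gt0.
have ec0 : 0 < excess_const p c1 c2 sigma.
  by rewrite !mulr_gt0 ?powR_gt0 ?peeling_const_gt0//; lra.
(* The two factors in the conclusion of [oracle_deterministic]. *)
pose Mt := 1 + K * C + K; pose Mb' := 1 + 3 / 2 * K.
have Mb'0 : 0 < Mb' by rewrite /Mb'; lra.
have KC0 : 0 < K * C by rewrite mulr_gt0//; lra.
have Mt0 : 0 < Mt by rewrite /Mt; lra.
exists Mt, (Mb' * excess_const p c1 c2 sigma); split=> //; split.
  by rewrite mulr_gt0.
move=> L rk N eps theta w d T P xi J Lam omega M x mhat Y pen risk _ eps0 _.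
move=> iid nrm w0 fin part M0 MA x1 sel.
have om0 j := level_partition_ge0 j part w0.
have pen0 m : 0 <= pen m.
  rewrite /pen /penalty !mulr_ge0 ?powR_ge0//; apply: sumr_ge0 => j _.
  by rewrite mulr_ge0 ?block_penalty_ge0// ltW.
pose Z o l := eps * xi l o.
pose V (m : {fset L}) o := \sum_(l <- m) w l * `|Z o l| `^ p.
pose bias (m : {fset L}) := fine (lp_loss w p theta) - \sum_(l <- m) w l * `|theta l| `^ p.
have b0 l : 0 <= w l * `|theta l| `^ p by rewrite mulr_ge0 ?powR_ge0.
have v0 o l : 0 <= w l * `|Z o l| `^ p by rewrite mulr_ge0 ?powR_ge0.
have tU U := proj1 (esum_lt_pinfty_fset U b0 fin).
have bias0 m : 0 <= bias m by rewrite subr_ge0; exact: tU.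
have V0 m o : 0 <= V m o by rewrite sumr_ge0.
have lossE m o : lp_loss w p (fun l => proj_estimator (Y o) m l - theta l)
    = (V m o + bias m)%:E by rewrite lp_loss_proj.
pose Rem := noise_excess p eps sigma (kappa p c1 c2 sigma) Lam omega x M xi.
have Rem0 o : 0 <= Rem o.
  apply: sumr_ge0 => j _; rewrite mulr_ge0 ?mulr_ge0 ?powR_ge0//.
  by apply: sumr_ge0 => mj _; rewrite mul1r le_max lexx orbT.
have mexc (j : J) (mj : {fset L}) : measurable_fun setT (fun o =>
    Num.max (\sum_(l <- mj) `|xi l o| `^ p
      - block_penalty p sigma (kappa p c1 c2 sigma) #|` mj| (x j mj)) 0).
  apply: measurable_maxr => //; apply: measurable_funB => //.
  exact: measurable_power_sum.
have mexcs (j : J) : measurable_fun setT (fun o =>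
    \sum_(mj <- traces M (Lam j) | mj != fset0) 1 *
    Num.max (\sum_(l <- mj) `|xi l o| `^ p
      - block_penalty p sigma (kappa p c1 c2 sigma) #|` mj| (x j mj)) 0).
  under eq_fun do rewrite -big_filter.
  by apply: measurable_sum => mj; exact: measurable_funM.
have mRem : measurable_fun setT Rem.
  by apply: measurable_sum => j; exact: measurable_funM.
have mV m : measurable_fun setT (V m).
  apply: measurable_sum => l; apply: measurable_funM => //.
  apply: (@measurableT_comp _ _ _ _ _ _ (fun r : R => r `^ p)).
    exact: measurable_powR.
  apply: (@measurableT_comp _ _ _ _ _ _ (@Num.norm R R)) => //.
  exact: measurable_funM.
(* [Rem] does not involve [mhat], so its expectation splits over blocks and traces, and
   [power_sum_excess] bounds each term. *)
have intRem : (\int[P]_o (Rem o)%:E <= (excess_const p c1 c2 sigma * eps `^ p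
    * remainder p Lam omega x M)%:E)%E.
  pose e j := \sum_(mj <- traces M (Lam j) | mj != fset0)
    1 * (excess_const p c1 c2 sigma
         * (#|` mj|%:R `^ Num.max (1 - p / 2) 0 * expR (- x j mj))).
  apply: (@le_trans _ _ (\sum_j eps `^ p * omega j * e j)%:E).
    apply: integral_sum_le => //.
    - move=> j o; apply: sumr_ge0 => mj _.
      by rewrite mul1r le_max lexx orbT.
    - by move=> j; rewrite mulr_ge0 ?powR_ge0.
    move=> j _ _; apply: integral_sum_le => //.
      by move=> mj o; rewrite le_max lexx orbT.
    by move=> mj mjT mj0; apply: power_sum_excess => //; exact: x1.
  rewrite lee_fin /remainder mulr_sumr; apply: ler_sum => j _.
  rewrite /e; under eq_bigr do rewrite mul1r.
  by rewrite -mulr_sumr le_eqVlt; apply/orP; left; apply/eqP; ring.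
have oracle m o : m \in M ->
    (lp_loss w p (fun l => proj_estimator (Y o) (mhat o) l - theta l)%R
     <= (Mt * (V m o + bias m + pen m) + Mb' * Rem o)%:E)%E.
  move=> mM; have [hM hmin] := sel o.
  rewrite lossE lee_fin.
  apply: (@oracle_deterministic _ _ _ _ (fun l => w l * `|Y o l| `^ p) _ _ _ _
    (pen (mhat o))) => //; first exact: ltW.
  - move=> l; rewrite -mulrDr mulrCA ler_wpM2l//.
    apply: le_trans (powRD_le_max (ltW p0) (normr_ge0 _) (normr_ge0 _)).
    apply: ge0_ler_powR; rewrite ?nnegrE ?(ltW p0) ?addr_ge0//.
    have -> : theta l = Y o l - Z o l by rewrite /Y /observation /Z addrK.
    exact: ler_normB.
  - move=> l; rewrite mulrCA [C * _]mulrCA -mulrDr ler_wpM2l//.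
    apply: le_trans (powC _ _ (normr_ge0 _) (normr_ge0 _)).
    apply: ge0_ler_powR; rewrite ?nnegrE ?(ltW p0) ?addr_ge0//.
    by rewrite addrC; exact: ler_normD.
  - exact: hmin.
  - exact: (@noise_le_penalty _ _ _ p eps sigma _ _ w Lam omega x M _ xi o _ eps0 (ltW k0) part w0 (MA _ hM) hM).
(* Moving the finite remainder to the left and dividing by [Mt] turns the claim into a lower bound
   on the infimum, to be checked for each [m] separately. *)
rewrite -leeBlDr// -lee_pdivrMl//; apply: le_ereal_inf_tmp => _ [m /= mM <-].
rewrite lee_pdivrMl// EFinN leeBlDr//.
apply: le_trans (ge0_le_integral_nonmeasurable P _ (fun o => oracle m o mM)) _.
  by move=> o; rewrite lossE lee_fin addr_ge0.
(* With [m] fixed and [mhat] gone, all integrands are measurable and the integral can be split. *)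
have Vbp0 o : 0 <= V m o + bias m + pen m.
  exact: addr_ge0 (addr_ge0 (V0 m o) (bias0 m)) (pen0 m).
have mVb : measurable_fun setT (fun o => V m o + bias m).
  exact: measurable_funD.
have mVp : measurable_fun setT (fun o => V m o + bias m + pen m).
  exact: measurable_funD.
under eq_integral do rewrite EFinD EFinM [(Mb' * _)%:E]EFinM.
rewrite ge0_integralD//; last 4 first.
- by move=> o _; apply: mule_ge0; rewrite lee_fin ?(ltW Mt0)// Vbp0.
- by apply: measurable_funeM; exact/measurable_EFinP.
- by move=> o _; apply: mule_ge0; rewrite lee_fin ?(ltW Mb'0).
- by apply: measurable_funeM; exact/measurable_EFinP.
rewrite ge0_integralZl ?lee_fin ?(ltW Mt0)//; last 2 first.
- exact/measurable_EFinP.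
- by move=> o _; rewrite lee_fin Vbp0.
rewrite ge0_integralZl ?lee_fin ?(ltW Mb'0)//; last 2 first.
- exact/measurable_EFinP.
- by move=> o _; rewrite lee_fin.
apply: leeD; last first.
  rewrite -2!(mulrA Mb') EFinM; apply: lee_wpmul2l => //.
  by rewrite lee_fin ltW.
apply: lee_wpmul2l; first by rewrite lee_fin ltW.
under eq_integral do rewrite EFinD.
rewrite ge0_integralD//; last 3 first.
- by move=> o _; rewrite lee_fin addr_ge0.
- exact/measurable_EFinP.
- by move=> o _; rewrite lee_fin.
rewrite integral_cst//.
rewrite [X in (_ + _ * X)%E](_ : _ = 1%E); last exact: probability_setT.
rewrite mule1 leeD2r//.
by rewrite /risk; under [leRHS]eq_integral do rewrite lossE.
Qed.
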